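(* Let $d\ge2$, let $A$ be a symmetric (Hermitian) positive definite matrix of size $n_1\cdots n_d\times n_1\cdots n_d$, and consider the system $Ax=y$ with exact solution $x_*=A^{-1}y$, initial guess $t$ and error $c=x_*-t\ne0$. Let $\tilde z=\tau(Z^{(1)},\dots,Z^{(d)})$ be an approximation in the tensor train format, with TT-ranks $\mathbf r=(r_0,\dots,r_d)$, of the residual $z=y-At$, whose interface matrices $Z^{\le k}$, $k=1,\dots,d-1$, have orthonormal columns. Let $x=t+v$, $v=\tau(V^{(1)},\dots,V^{(d)})$, be the result of the following algorithm: for $k=d,d-1,\dots,1$ successively, choose $$V^{(k)}\in\arg\min_{X^{(k)}\in\mathbb C^{r_{k-1}\times n_k\times r_k}} J\bigl(t+\tau(Z^{(1)},\dots,Z^{(k-1)},X^{(k)},V^{(k+1)},\dots,V^{(d)})\bigr),\qquad J(u)=\|x_*-u\|_A^2 .$$ Then the error after this step is bounded by $$\|x_*-x\|_A^2\le \nu_1^2\Bigl(\omega_1^2+(1-\omega_1^2)\,\nu_2^2\bigl(\omega_2^2+(1-\omega_2^2)\,\nu_3^2(\omega_3^2+\dots+\nu_{d-1}^2\omega_{d-1}^2)\cdots\bigr)\Bigr)\|c\|_A^2$$ $$=\left(\sum_{k=1}^{d-1}\omega_k^2\prod_{j=1}^{k-1}(1-\omega_j^2)\prod_{j=1}^{k}\nu_j^2\right)\|c\|_A^2,$$ where $$\omega_k^2=1-\frac{(c,R_{\mathcal Z_{\le k}}c)_A}{(c,c)_A},\qquad \nu_k\le1,\qquad k=1,\dots,d-1,$$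 and $\nu_k\ge 0$ is the progress of the ALS microstep over the $k$-th core, as defined in the context.
   Context: $u^*$ is the (conjugate) transpose; for a Hermitian positive definite matrix $M$, $(u,w)_M=u^*Mw$ and $\|u\|_M^2=(u,u)_M$. For a matrix $U$ with linearly independent columns, $R_U=U(U^*AU)^{-1}U^*A$ is the $A$-orthogonal projector onto the span of its columns. Tensor train (TT) format: for cores $X^{(k)}\in\mathbb C^{r_{k-1}\times n_k\times r_k}$, viewed as $r_{k-1}\times r_k$ matrices $X^{(k)}(i_k)$ depending on $i_k=1,\dots,n_k$, with $r_0=r_d=1$, the tensor (vector of length $n_1\cdots n_d$) $\tau(X^{(1)},\dots,X^{(d)})$ has entries $X^{(1)}(i_1)X^{(2)}(i_2)\cdots X^{(d)}(i_d)$. The integers $r_k$ are the TT-ranks. More generally, for $k\ge1$, $\tau(X^{(k)},\dots,X^{(d)})$ denotes the vector of length $r_{k-1}n_k\cdots n_d$ with entries, at multi-index $\overline{\alpha_{k-1}i_k\ldots i_d}$, equal to the $\alpha_{k-1}$-th component of $X^{(k)}(i_k)\cdots X^{(d)}(i_d)$. Interface matrices: $Z^{\le k}\in\mathbb C^{n_1\cdots n_k\times r_k}$ has row $\overline{i_1\ldots i_k}$ equal to $Z^{(1)}(i_1)\cdots Z^{(k)}(i_k)$. Put $\mathcal Z_{\le k}=Z^{\le k}\otimes I_{n_{k+1}}\otimes\dots\otimes I_{n_d}\in\mathbb C^{n_1\cdots n_d\times r_kn_{k+1}\cdots n_d}$ (Kronecker product) for $1\le k\le d-1$, and $\mathcal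 Z_{\le 0}=I$. Thus $\tau(Z^{(1)},\dots,Z^{(k)},X^{(k+1)},\dots,X^{(d)})=\mathcal Z_{\le k}\,\tau(X^{(k+1)},\dots,X^{(d)})$. Reduced problems: for $0\le k\le d-1$ let $A_k=\mathcal Z_{\le k}^*A\mathcal Z_{\le k}$ and let $v_{>k,*}=A_k^{-1}\mathcal Z_{\le k}^*z$ be the minimizer of $J(t+\mathcal Z_{\le k}w)$ over all $w\in\mathbb C^{r_kn_{k+1}\cdots n_d}$ (so $A_0=A$ and $v_{>0,*}=c$). Progress of the ALS microstep over core $k$ ($1\le k\le d-1$), when $Z^{(k)}$ is replaced by $V^{(k)}$: $\nu_k\ge0$ with $$\nu_k^2=\frac{\|v_{>k-1,*}-\tau(V^{(k)},V^{(k+1)},\dots,V^{(d)})\|_{A_{k-1}}^2}{\|v_{>k-1,*}-\tau(Z^{(k)},V^{(k+1)},\dots,V^{(d)})\|_{A_{k-1}}^2},$$ with $\nu_k=1$ if the denominator vanishes. *)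

(* Defs.v *)
From HB Require Import structures.
From mathcomp Require Import all_boot all_order all_algebra.
From mathcomp Require Import mxtens.

Set Implicit Arguments.
Unset Strict Implicit.
Unset Printing Implicit Defensive.

Import Order.TTheory GRing.Theory Num.Theory.
Local Open Scope ring_scope.
Local Open Scope sesquilinear_scope.

Section EnergyNorm.
Variable C : numClosedFieldType.

Definition inner n (M : 'M[C]_n) (u w : 'cV[C]_n) : C := (u^t* *m M *m w) 0 0.

Definition posdefmx n (M : 'M[C]_n) : Prop :=
  M \is hermsymmx /\ forall u : 'cV[C]_n, u != 0 -> 0 < inner M u u.

Definition sqnorm n (M : 'M[C]_n) (u : 'cV[C]_n) : C := inner M u u.

Definition orthonormal_cols m n (U : 'M[C]_(m, n)) : Prop :=
  U^t* *m U = 1%:M.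

Definition energy_proj m n (A : 'M[C]_m) (U : 'M[C]_(m, n)) : 'M[C]_m :=
  U *m invmx (U^t* *m A *m U) *m U^t* *m A.

End EnergyNorm.

(* lsize n k = n_1 * ... * n_k  and  rsize n k m = n_(k+1) * ... * n_(k+m);
   they are fixpoints so that the row type of a core product unfolds to the
   products over which [mxtens_index] ranges. *)
Fixpoint lsize (n : nat -> nat) (k : nat) : nat :=
  if k is k'.+1 then (lsize n k' * n k'.+1)%N else 1%N.

Fixpoint rsize (n : nat -> nat) (k m : nat) : nat :=
  if m is m'.+1 then (n k.+1 * rsize n k.+1 m')%N else 1%N.

Lemma lsize_rsize n d k :
  (k <= d)%N -> (lsize n k * rsize n k (d - k))%N = lsize n d.
Proof.
move=> le_kd; rewrite -[in RHS](subnKC le_kd).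
move: (d - k)%N => m {le_kd}; elim: m k => [|m IHm] k /=; first by rewrite muln1 addn0.
by rewrite mulnA -addSnnS -IHm.
Qed.

Section TensorTrain.
Variables (C : numClosedFieldType) (n r : nat -> nat).

(* Cores are numbered from 1, as are the mode sizes n_1, n_2, ...; the core
   with index 0 of a family is never used. *)
Definition core (k : nat) : Type := {ffun 'I_(n k) -> 'M[C]_(r k.-1, r k)}.

Definition cores : Type := forall k, core k.

(* Multi-indices are linearized in lexicographic order (leftmost index slowest),
   which is the order of [mxtens_index] and of the Kronecker product [*t].
   The entry 1 in the base case is the empty product of cores, since r_0 = 1. *)
Fixpoint interface (X : cores) (k : nat) : 'M[C]_(lsize n k, r k) :=
  match k with
  | 0 => const_mx 1
  | k'.+1 => \matrix_(i, j)
      (row (mxtens_unindex i).1 (interface X k')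
         *m X k'.+1 (mxtens_unindex i).2) 0 j
  end.

(* tail X k m is tau(X^(k+1), ..., X^(k+m)), for k + m the index of the last
   core; the base case is again the empty product, since the last rank is 1. *)
Fixpoint tail (X : cores) (k m : nat) : 'cV[C]_(r k * rsize n k m) :=
  match m with
  | 0 => const_mx 1
  | m'.+1 => \col_i
      let a := (mxtens_unindex i).1 in
      let jl := mxtens_unindex (mxtens_unindex i).2 in
      \sum_(b < r k.+1) X k.+1 jl.1 a b * tail X k.+1 m' (mxtens_index (b, jl.2)) 0
  end.

Variable d : nat.

(* [conform_mx 0] only transports along r_d = 1. *)
Definition tau (X : cores) : 'cV[C]_(lsize n d) := conform_mx 0 (interface X d).

(* [conform_mx 0] only transports along [lsize_rsize], for k <= d. For k = 0
   and r_0 = 1 this matrix is the identity. *)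
Definition frame (Z : cores) (k : nat) :
    'M[C]_(lsize n d, r k * rsize n k (d - k)) :=
  conform_mx 0 (interface Z k *t (1%:M : 'M[C]_(rsize n k (d - k)))).

Definition splice (k : nat) (Z V : cores) : cores :=
  fun j => if (j < k)%N then Z j else V j.

Section Problem.
Variables (A : 'M[C]_(lsize n d)) (y t : 'cV[C]_(lsize n d)).

Definition energy (u : 'cV[C]_(lsize n d)) : C := sqnorm A (invmx A *m y - u).

(* [dfwith F X] is the family F with its core k replaced by X : core k. *)
Definition als_sweep (Z V : cores) : Prop :=
  forall k, (1 <= k <= d)%N -> forall X : core k,
    energy (t + tau (splice k Z V)) <= energy (t + tau (dfwith (splice k Z V) X)).

Definition reduced_mx (Z : cores) (k : nat) : 'M[C]_(r k * rsize n k (d - k)) :=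
  (frame Z k)^t* *m A *m frame Z k.

Definition reduced_sol (Z : cores) (k : nat) : 'cV[C]_(r k * rsize n k (d - k)) :=
  invmx (reduced_mx Z k) *m (frame Z k)^t* *m (y - A *m t).

Definition reduced_sqerr (Z : cores) (k : nat) (X : cores) : C :=
  sqnorm (reduced_mx Z k) (reduced_sol Z k - tail X k (d - k)).

(* splice k.+1 Z V has the cores Z^(k), V^(k+1), ..., V^(d) from position k on. *)
Definition progress (Z V : cores) (k : nat) : C :=
  let num := reduced_sqerr Z k.-1 V in
  let den := reduced_sqerr Z k.-1 (splice k.+1 Z V) in
  if den == 0 then 1 else sqrtC (num / den).

Definition omega (Z : cores) (k : nat) : C :=
  let c := invmx A *m y - t in
  sqrtC (1 - inner A c (energy_proj A (frame Z k) *m c) / inner A c c).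

End Problem.

End TensorTrain.

(* nu_1^2 (om_1^2 + (1 - om_1^2) nu_2^2 (om_2^2 + ... + nu_(d-1)^2 om_(d-1)^2)) *)
Definition nested_bound (C : numClosedFieldType) (d : nat) (nu om : nat -> C) : C :=
  foldr (fun k b => nu k ^+ 2 * (om k ^+ 2 + (1 - om k ^+ 2) * b)) 0 (iota 1 d.-1).

(* Main.v *)
(* Write F_k for the frame of Z^(<=k), cc = (c,c)_A and E_k for the squared error of
   tau(V^(k+1),...,V^(d)) in the k-th reduced problem. By the Pythagorean identity in the
   A-inner product, |c - F_k w|_A^2 = om_k^2 cc + |v_{>k,*} - w|_{A_k}^2 for every w.
   Applying it with F_(k-1) and with F_k to tau(Z^(1),...,Z^(k),V^(k+1),...,V^(d)) turns
   the definition of nu_k into E_(k-1) = nu_k^2 ((om_k^2 - om_(k-1)^2) cc + E_k), where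
   om_0 = 0, and E_(d-1) = 0 because the last core is unconstrained. The nested bound
   follows by descending induction on k. *)
Require Import Defs.
From mathcomp Require Import all_boot all_order all_algebra.
From mathcomp Require Import mxtens ring zify.
Import Order.TTheory GRing.Theory Num.Theory.
Local Open Scope ring_scope.
Local Open Scope sesquilinear_scope.

(** * Positive definite forms and the A-orthogonal projection *)

Section EnergyNormTheory.
Set Implicit Arguments.
Unset Strict Implicit.
Variable C : numClosedFieldType.

Lemma adjmxM m n p (A : 'M[C]_(m, n)) (B : 'M[C]_(n, p)) :
  (A *m B)^t* = B^t* *m A^t*.
Proof. by rewrite trmx_mul map_mxM. Qed.

Lemma adjmxB m n (A B : 'M[C]_(m, n)) : (A - B)^t* = A^t* - B^t*.
Proof. by rewrite linearB map_mxB. Qed.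

Lemma hermsymmxE n (A : 'M[C]_n) : (A \is hermsymmx) = (A^t* == A).
Proof. by rewrite is_hermitianmxE expr0 scale1r eq_sym. Qed.

Lemma posdefmx_adj n (A : 'M[C]_n) : posdefmx A -> A^t* = A.
Proof. by case; rewrite hermsymmxE => /eqP. Qed.

Lemma posdefmx_unit n (A : 'M[C]_n) : posdefmx A -> A \in unitmx.
Proof.
move=> [_ Apos]; rewrite unitmxE unitfE; apply/negP => /det0P[v v0 vA].
(* [det0P] yields a row vector in the left kernel, so its adjoint is the column vector to test. *)
have := Apos (v^t*); rewrite /inner trmxCK vA mul0mx mxE ltxx => H.
apply/negP: v0; rewrite negbK; apply/eqP; rewrite -[v]trmxCK.
have [->|/H //] := eqVneq (v^t*) 0.
by rewrite trmx0 map_mx0.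
Qed.

Lemma sqnorm0 n (A : 'M[C]_n) : sqnorm A 0 = 0.
Proof. by rewrite /sqnorm /inner mulmx0 mxE. Qed.

Lemma sqnorm_ge0 n (A : 'M[C]_n) u : posdefmx A -> 0 <= sqnorm A u.
Proof.
move=> [_ Apos]; have [->|/Apos/ltW //] := eqVneq u 0.
by rewrite sqnorm0.
Qed.

Lemma posdefmx_congr m n (A : 'M[C]_m) (F : 'M[C]_(m, n)) :
  posdefmx A -> orthonormal_cols F -> posdefmx (F^t* *m A *m F).
Proof.
move=> Apd Fo; split.
  by rewrite hermsymmxE !adjmxM trmxCK (posdefmx_adj Apd) mulmxA.
move=> u u0; suff: 0 < inner A (F *m u) (F *m u) by rewrite /inner adjmxM !mulmxA.
apply: (proj2 Apd); apply: contraNneq u0 => Fu0.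
by rewrite -[u]mul1mx -Fo -mulmxA Fu0 mulmx0.
Qed.

(** The reduced solution [w0] solves the normal equations [Mw0], so F w0 is the A-orthogonal
    projection of [c] and the cross terms on both sides agree. Orthonormal columns make [M] positive
    definite, hence invertible. *)
Lemma sqnorm_sub_range m n (A : 'M[C]_m) (F : 'M[C]_(m, n)) c w :
  posdefmx A -> orthonormal_cols F ->
  let M := F^t* *m A *m F in
  sqnorm A (c - F *m w) =
    inner A c c - inner A c (energy_proj A F *m c)
    + sqnorm M (invmx M *m F^t* *m (A *m c) - w).
Proof.
move=> Apd Fo M; have Mpd : posdefmx M by exact: posdefmx_congr.
set w0 := invmx M *m _ *m _; have Mu := posdefmx_unit Mpd.
have Mw0 : M *m w0 = F^t* *m A *m c by rewrite /w0 !mulmxA mulmxV // mul1mx.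
have w0M : w0^t* *m M = c^t* *m A *m F.
  rewrite -[M](posdefmx_adj Mpd) -adjmxM Mw0 !adjmxM trmxCK.
  by rewrite (posdefmx_adj Apd) mulmxA.
rewrite /sqnorm /inner /energy_proj !adjmxB adjmxM !mulmxBl !mulmxBr w0M.
have -> : w^t* *m M *m w0 = w^t* *m F^t* *m A *m c by rewrite -mulmxA Mw0 !mulmxA.
have -> : c^t* *m A *m (F *m invmx M *m F^t* *m A *m c) = c^t* *m A *m F *m w0.
  by rewrite /w0 !mulmxA.
rewrite /M !mulmxA !mxE; ring.
Qed.

End EnergyNormTheory.

(** * Factorization of a tensor train through interface and frame matrices *)

Section TensorTrainTheory.
Set Implicit Arguments.
Unset Strict Implicit.
Variables (C : numClosedFieldType) (n r : nat -> nat).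
Implicit Types X Y Z V : cores C n r.

Lemma interface_ext X Y k :
  (forall j, (1 <= j <= k)%N -> X j = Y j) -> interface X k = interface Y k.
Proof.
elim: k => [//|k IHk] XY /=; rewrite IHk => [|j jk]; last by apply: XY; lia.
by rewrite XY ?leqnn.
Qed.

Lemma tail_ext X Y k m :
  (forall j, (k < j <= k + m)%N -> X j = Y j) -> tail X k m = tail Y k m.
Proof.
elim: m k => [//|m IHm] k XY /=; rewrite (IHm k.+1) => [|j jk]; last by apply: XY; lia.
by rewrite XY //; lia.
Qed.

Lemma big_ord_eq1 (p : nat) (F : 'I_p -> C) j : p = 1%N -> \sum_i F i = F j.
Proof. by move=> p1; subst p; rewrite big_ord1 [j]ord1. Qed.

Lemma interfaceS X k p j b :
  interface X k.+1 (mxtens_index (p, j)) b = \sum_a interface X k p a * X k.+1 j a b.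
Proof. by rewrite mxE mxtens_indexK mxE; apply: eq_bigr => a _; rewrite mxE. Qed.

Lemma tailS X k m a j l :
  tail X k m.+1 (mxtens_index (a, mxtens_index (j, l))) 0
  = \sum_b X k.+1 j a b * tail X k.+1 m (mxtens_index (b, l)) 0.
Proof. by rewrite mxE !mxtens_indexK. Qed.

(** Induction on [m] moves core k+1 from the tail into the interface. The row counts [lsize n K] and
    [lsize n k * rsize n k m] are equal only propositionally, so [K] is free and [i] is tied to [p]
    and [q] by its numeric value. *)
Lemma interface_split X k m K (i : 'I_(lsize n K)) (j : 'I_(r K))
    (p : 'I_(lsize n k)) (q : 'I_(rsize n k m)) :
  K = (k + m)%N -> r K = 1%N -> i = (p * rsize n k m + q)%N :> nat ->
  interface X K i j = \sum_a interface X k p a * tail X k m (mxtens_index (a, q)) 0.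
Proof.
elim: m k p q => [|m IHm] k p q defK rK defi.
  rewrite addn0 in defK; subst k.
  have -> : i = p by apply: val_inj; case: q defi => q /= ltq1 ->; lia.
  under eq_bigr do rewrite mxE mulr1.
  by rewrite (big_ord_eq1 _ j).
case: (@mxtens_indexP (n k.+1) (rsize n k.+1 m) q) defi => {q} j' l defi.
rewrite (IHm k.+1 (mxtens_index (p, j')) l) //; last 2 first.
- by rewrite defK addnS.
- by rewrite defi /= mulnDl addnA mulnA.
under eq_bigr => b _ do rewrite interfaceS mulr_suml.
rewrite exchange_big; apply: eq_bigr => a _.
by rewrite tailS mulr_sumr; apply: eq_bigr => b _; rewrite mulrA.
Qed.

Lemma mulmx_tensmx1 m p s (B : 'M[C]_(m, p)) (w : 'cV[C]_(p * s)) i q :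
  ((B *t (1%:M : 'M_s)) *m w) (mxtens_index (i, q)) 0
  = \sum_a B i a * w (mxtens_index (a, q)) 0.
Proof.
pose F a b := (B *t (1%:M : 'M_s)) (mxtens_index (i, q)) (mxtens_index (a, b))
  * w (mxtens_index (a, b)) 0.
transitivity (\sum_(x : 'I_p * 'I_s) F x.1 x.2).
  rewrite mxE (reindex (@mxtens_index p s)) /=; first by apply: eq_bigr => -[].
  by exists (@mxtens_unindex p s) => x _; rewrite ?mxtens_indexK ?mxtens_unindexK.
rewrite -(pair_bigA _ F) /F; apply: eq_bigr => a _.
rewrite (bigD1 q) //= big1 ?addr0 => [|b /negPf neq_bq].
  by rewrite tensmxE mxE eqxx mulr1.
by rewrite tensmxE mxE eq_sym neq_bq mulr0 mul0r.
Qed.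

(** When sizes agree, [conform_mx] is a transport and never takes its default; this lemma and the
    next trade it for a cast of the index. *)
Lemma conform_mulmx m m' p (B : 'M[C]_(m, p)) (w : 'cV[C]_p) i (e : m = m') :
  ((conform_mx 0 B : 'M_(m', p)) *m w) i 0 = (B *m w) (cast_ord (esym e) i) 0.
Proof. by move: i; subst m' => i; rewrite conform_mx_id cast_ord_id. Qed.

Lemma conform_cvE m p (B : 'M[C]_(m, p)) (w : 'cV[C]_m) i (e : p = 1%N) :
  (conform_mx w B) i 0 = B i (cast_ord (esym e) 0).
Proof. by subst p; rewrite conform_mx_id cast_ord_id. Qed.

Lemma conform_isometry m m' p (B : 'M[C]_(m, p)) :
  m = m' -> orthonormal_cols B -> orthonormal_cols (conform_mx (0 : 'M_(m', p)) B).
Proof. by move=> e; subst m'; rewrite conform_mx_id. Qed.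

(** A square isometry is unitary. The sizes of the frame at 0 agree only propositionally, hence the
    equation [p = m]. *)
Lemma isometry_surj m p (F : 'M[C]_(m, p)) (c : 'cV_m) :
  p = m -> orthonormal_cols F -> F *m (F^t* *m c) = c.
Proof. by move=> e; subst p => /mulmx1C FF; rewrite mulmxA FF mul1mx. Qed.

Variable d : nat.

Lemma frame_tail X k : (k <= d)%N -> r d = 1%N ->
  frame d X k *m tail X k (d - k) = tau d X.
Proof.
move=> le_kd rd; apply/matrixP => i j; rewrite {j}ord1.
rewrite /frame (conform_mulmx _ _ _ (lsize_rsize n le_kd)) /tau (conform_cvE _ _ _ rd).
(* [i'] is [i] retyped as an index of the Kronecker product, so that it splits into a pair. *)
set i' := cast_ord _ i; have ii' : i' = i :> nat by [].
case: (mxtens_indexP i') ii' => p q /= ii'.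
rewrite mulmx_tensmx1; symmetry; apply: interface_split; rewrite ?subnKC //.
Qed.

Lemma frame_ext X Y k :
  (forall j, (1 <= j <= k)%N -> X j = Y j) -> frame d X k = frame d Y k.
Proof. by move=> XY; rewrite /frame (interface_ext XY). Qed.

Lemma tau_ext X Y :
  (forall j, (1 <= j <= d)%N -> X j = Y j) -> tau d X = tau d Y.
Proof. by move=> XY; rewrite /tau (interface_ext XY). Qed.

(** [splice] keeps Z strictly below its index, so retaining the cores 1 to k of Z takes [k.+1]. *)
Lemma frame_splice_tail Z V k : (k <= d)%N -> r d = 1%N ->
  frame d Z k *m tail V k (d - k) = tau d (splice k.+1 Z V).
Proof.
move=> le_kd rd; rewrite -(frame_tail (splice k.+1 Z V) le_kd rd).
congr (_ *m _); [apply: frame_ext | apply: tail_ext] => j jk.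
  by rewrite /splice ifT //; lia.
by rewrite /splice ifF //; lia.
Qed.

(** The Gram matrix of a Kronecker product with the identity is the Gram matrix of the first factor
    tensored with the identity. *)
Lemma frame_orthonormal Z k : (k <= d)%N ->
  orthonormal_cols (interface Z k) -> orthonormal_cols (frame d Z k).
Proof.
move=> le_kd Zo; apply: conform_isometry; first exact: lsize_rsize.
rewrite /orthonormal_cols trmx_tens trmx1; set B := map_mx _ _.
have -> : B = (interface Z k)^t* *t 1%:M.
  apply/matrixP => i j; case: (mxtens_indexP i) => i1 i2.
  by case: (mxtens_indexP j) => j1 j2; rewrite mxE !tensmxE !mxE rmorphM /= rmorph_nat.
rewrite tensmx_mul Zo mul1mx; apply/matrixP => i j.
case: (mxtens_indexP i) => i1 i2; case: (mxtens_indexP j) => j1 j2.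
rewrite tensmxE !mxE (can_eq (@mxtens_indexK _ _)) xpair_eqE.
by case: eqP; case: eqP; rewrite ?mulr0 ?mul0r ?mulr1.
Qed.

Lemma interface0_orthonormal Z : r 0%N = 1%N -> orthonormal_cols (interface Z 0).
Proof.
move=> r0; apply/matrixP => i j; rewrite !mxE big_ord1 !mxE conjC1 mulr1.
suff -> : i = j by rewrite eqxx.
by apply: val_inj; case: i j => i ? [j ?] /=; lia.
Qed.

(** A core whose right rank is 1 is an arbitrary vector, reshaped; this is why the last microstep
    problem is unconstrained. [p] is a variable because it gets instantiated by [d - d.-1]. *)
Lemma tail_last k p (w : 'cV[C]_(r k * rsize n k p)) :
  p = 1%N -> r k.+1 = 1%N ->
  exists X : core C n r k.+1, forall Y, Y k.+1 = X -> tail Y k p = w.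
Proof.
move=> p1 rk1; subst p.
exists [ffun j => \matrix_(a, b) w (mxtens_index (a, mxtens_index (j, ord0))) 0].
move=> Y YX; apply/matrixP => i j; rewrite {j}ord1.
case: (mxtens_indexP i) => a s.
case: (@mxtens_indexP (n k.+1) 1 s) => j l; rewrite tailS YX.
under eq_bigr do rewrite ffunE !mxE mulr1.
by rewrite sumr_const card_ord rk1 mulr1n [l]ord1.
Qed.

End TensorTrainTheory.

(** * The scalar recursion behind the nested bound *)

Section NestedBound.
Set Implicit Arguments.
Unset Strict Implicit.
Variables (C : numClosedFieldType) (nu om : nat -> C).

(** The levels of the nested bound from [k] inwards: [nested_bound d nu om] is the case of start 1
    and length [d.-1]. The free start allows induction. *)
Definition nested_tail k m : C :=
  foldr (fun k b => nu k ^+ 2 * (om k ^+ 2 + (1 - om k ^+ 2) * b)) 0 (iota k m).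

(** Peeling level k leaves the term nu_k^2 om_k^2 and multiplies all later terms by nu_k^2 (1 -
    om_k^2). *)
Lemma nested_tail_sum k m :
  nested_tail k m = \sum_(k <= j < k + m)
    om j ^+ 2 * (\prod_(k <= i < j) (1 - om i ^+ 2)) * (\prod_(k <= i < j.+1) nu i ^+ 2).
Proof.
elim: m k => [|m IHm] k; first by rewrite addn0 big_geq.
rewrite /nested_tail /= -/(nested_tail k.+1 m) IHm addnS big_ltn ?ltnS ?leq_addr //.
rewrite big_geq // big_nat1 mulr1 mulrDr [nu k ^+ 2 * _]mulrC; congr (_ + _).
rewrite -addSn mulrA mulr_sumr; apply: eq_big_nat => j /andP[lt_kj _].
rewrite [in RHS]big_ltn // [X in _ = _ * X]big_ltn ?ltnS ?(ltnW lt_kj) //; ring.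
Qed.

(** [e] stands for (c,c)_A and [E k] for the squared error in the k-th reduced problem. *)
Variables (d : nat) (e : C) (E : nat -> C).
Hypothesis e_ge0 : 0 <= e.
Hypothesis om01 : forall k, (k < d)%N -> 0 <= om k ^+ 2 <= 1.
Hypothesis nu01 : forall k, (1 <= k < d)%N -> 0 <= nu k <= 1.
Hypothesis E_rec : forall k, (k.+1 < d)%N ->
  E k = nu k.+1 ^+ 2 * ((om k.+1 ^+ 2 - om k ^+ 2) * e + E k.+1).
Hypothesis E_last : E d.-1 = 0.

(** Each level is nu_k^2 times a convex combination of 1 and the next level, so the interval [0,1]
    is preserved. *)
Lemma nested_tail_bounds k m : (1 <= k)%N -> (k + m <= d)%N ->
  0 <= nested_tail k m <= 1.
Proof.
elim: m k => [|m IHm] k k1 kmd; first by rewrite lexx ler01.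
rewrite /nested_tail /= -/(nested_tail k.+1 m).
have /andP[b0 b1] : 0 <= nested_tail k.+1 m <= 1 by apply: IHm; lia.
have /andP[o0 o1] : 0 <= om k ^+ 2 <= 1 by apply: om01; lia.
have /andP[n0 n1] : 0 <= nu k <= 1 by apply: nu01; lia.
have o1' : 0 <= 1 - om k ^+ 2 by rewrite subr_ge0.
have s0 : 0 <= om k ^+ 2 + (1 - om k ^+ 2) * nested_tail k.+1 m.
  by apply: addr_ge0 => //; apply: mulr_ge0.
have s1 : om k ^+ 2 + (1 - om k ^+ 2) * nested_tail k.+1 m <= 1.
  by rewrite addrC -lerBrDr ler_piMr.
by rewrite mulr_ge0 ?exprn_ge0 //= mulr_ile1 ?exprn_ge0 ?exprn_ile1.
Qed.

(* Replacing om_(k+1)^2 - om_k^2 by (1 - om_k^2) om_(k+1)^2 costs nothing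
   because the remaining nested factor is at most 1. *)
Lemma nested_tail_error k m : (k.+1 + m = d)%N ->
  E k <= (1 - om k ^+ 2) * nested_tail k.+1 m * e.
Proof.
elim: m k => [|m IHm] k kmd.
  by rewrite mulr0 mul0r (_ : k = d.-1) ?E_last //; lia.
rewrite E_rec; last by lia.
rewrite /nested_tail /= -/(nested_tail k.+2 m); set b := nested_tail k.+2 m.
have /andP[b0 b1] : 0 <= b <= 1 by apply: nested_tail_bounds; lia.
have /andP[o0 o1] : 0 <= om k ^+ 2 <= 1 by apply: om01; lia.
have /andP[p0 p1] : 0 <= om k.+1 ^+ 2 <= 1 by apply: om01; lia.
have /andP[n0 n1] : 0 <= nu k.+1 <= 1 by apply: nu01; lia.
have Ek1 : E k.+1 <= (1 - om k.+1 ^+ 2) * b * e by apply: IHm; lia.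
move: (om k ^+ 2) (om k.+1 ^+ 2) o0 o1 p0 p1 Ek1 => o p o0 o1 p0 p1 Ek1.
have -> : (1 - o) * (nu k.+1 ^+ 2 * (p + (1 - p) * b)) * e
          = nu k.+1 ^+ 2 * ((1 - o) * (p + (1 - p) * b) * e) by ring.
apply: ler_wpM2l; first by rewrite exprn_ge0.
apply: le_trans (lerD (lexx _) Ek1) _; rewrite -subr_ge0.
have -> : (1 - o) * (p + (1 - p) * b) * e - ((p - o) * e + (1 - p) * b * e)
          = o * (1 - p) * (1 - b) * e by ring.
by rewrite !mulr_ge0 ?subr_ge0.
Qed.

End NestedBound.

(** * From the sweep to the hypotheses of the scalar recursion *)

Theorem theorem3 (C : numClosedFieldType) (d : nat) (n r : nat -> nat)
    (A : 'M[C]_(lsize n d)) (y t x : 'cV[C]_(lsize n d)) (Z V : cores C n r) :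
  (2 <= d)%N -> r 0%N = 1%N -> r d = 1%N ->
  posdefmx A ->
  let xstar := invmx A *m y in
  let c := xstar - t in
  c != 0 ->
  (forall k, (1 <= k <= d.-1)%N -> orthonormal_cols (interface Z k)) ->
  als_sweep A y t Z V ->
  x = t + tau d V ->
  let nu := progress A y t Z V in
  let om := omega A y t Z in
  let bound := \sum_(1 <= k < d)
    om k ^+ 2 * (\prod_(1 <= j < k) (1 - om j ^+ 2))
             * (\prod_(1 <= j < k.+1) nu j ^+ 2) in
  [/\ sqnorm A (xstar - x) <= nested_bound d nu om * sqnorm A c,
      nested_bound d nu om * sqnorm A c = bound * sqnorm A c
    & forall k, (1 <= k <= d.-1)%N -> 0 <= nu k <= 1].
Proof.
move=> d2 r0 rd Apd xstar c c0 Zo sweep -> nu om bound.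
have Au := posdefmx_unit Apd.
have cc_gt0 : 0 < sqnorm A c by exact: (proj2 Apd).
have Ac : A *m c = y - A *m t by rewrite mulmxBr mulmxA mulmxV // mul1mx.
have Fo k : (k < d)%N -> orthonormal_cols (frame d Z k).
  move=> kd; apply: frame_orthonormal; first exact: ltnW.
  case: k kd => [|k] kd; first exact: interface0_orthonormal.
  by apply: Zo; lia.
have Mpd k : (k < d)%N -> posdefmx (reduced_mx A Z k).
  by move=> kd; exact: posdefmx_congr (Fo k kd).
have split_error k w : (k < d)%N -> sqnorm A (c - frame d Z k *m w) =
    om k ^+ 2 * sqnorm A c + sqnorm (reduced_mx A Z k) (reduced_sol A y t Z k - w).
  move=> kd; rewrite (sqnorm_sub_range c w Apd (Fo k kd)) /om /omega sqrtCK.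
  rewrite mulrBl mul1r divfK ?(lt0r_neq0 cc_gt0) //.
  by rewrite Ac.
have om_k01 k : (k < d)%N -> 0 <= om k ^+ 2 <= 1.
  move=> kd; rewrite -(pmulr_lge0 _ cc_gt0) -[_ <= 1](ler_pM2r cc_gt0) mul1r.
  (* At the reduced solution the second term vanishes, giving the lower bound; at 0 the left side is
     (c,c)_A, giving the upper one. *)
  have := split_error k (reduced_sol A y t Z k) kd.
  have := split_error k 0 kd; rewrite mulmx0 !subr0 subrr sqnorm0 addr0 => e0 e1.
  apply/andP; split; first by rewrite -e1 sqnorm_ge0.
  by rewrite [leRHS]e0 lerDl sqnorm_ge0 //; exact: Mpd.
have om0 : om 0%N ^+ 2 = 0.
  have d0 : (0 < d)%N by lia.
  have sizeF : (r 0 * rsize n 0 (d - 0))%N = lsize n d.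
    by rewrite r0 -(lsize_rsize n (leq0n d)).
  (* The frame at 0 is a square isometry, so this vector reproduces [c] exactly and a sum of two
     nonnegative terms is zero. *)
  have := split_error 0%N ((frame d Z 0)^t* *m c) d0.
  rewrite isometry_surj //; last exact: Fo.
  rewrite subrr sqnorm0 => /esym/eqP.
  have /andP[o0 _] := om_k01 _ d0.
  have oc0 : 0 <= om 0%N ^+ 2 * sqnorm A c by apply: mulr_ge0 => //; exact: ltW.
  rewrite paddr_eq0 ?sqnorm_ge0 //; last exact: Mpd.
  by rewrite mulf_eq0 (negPf (lt0r_neq0 cc_gt0)) orbF => /andP[/eqP].
have energyE X : energy A y (t + X) = sqnorm A (c - X).
  by rewrite /energy opprD addrA.
have splice_error k X : (k < d)%N ->
    energy A y (t + tau d (splice k.+1 Z X)) =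
    om k ^+ 2 * sqnorm A c + reduced_sqerr A y t Z k X.
  by move=> kd; rewrite energyE -frame_splice_tail ?(ltnW kd) // split_error.
(* The same tensor also has a description one index lower, where Z^(k+1) belongs to the tail instead
   of the frame. *)
have splice_den k : (k.+1 < d)%N ->
    energy A y (t + tau d (splice k.+2 Z V)) =
    om k ^+ 2 * sqnorm A c + reduced_sqerr A y t Z k (splice k.+2 Z V).
  move=> kd; rewrite -splice_error; last exact: ltnW.
  congr (energy _ _ (_ + _)); apply: tau_ext => j _; rewrite /splice.
  by case: (ltnP j k.+1) => // jk; rewrite ifT //; lia.
have err_ge0 k X : (k < d)%N -> 0 <= reduced_sqerr A y t Z k X.
  by move=> kd; apply: sqnorm_ge0; exact: Mpd.
have num_le_den k : (k.+1 < d)%N ->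
    reduced_sqerr A y t Z k V <= reduced_sqerr A y t Z k (splice k.+2 Z V).
  move=> kd; rewrite -(lerD2l (om k ^+ 2 * sqnorm A c)) -splice_error ?(ltnW kd) //.
  rewrite -splice_den //.
  have k1 : (1 <= k.+1 <= d)%N by lia.
  (* Keeping the old core Z^(k+1) is a competitor in the microstep over core k+1. *)
  apply: le_trans (sweep _ k1 (Z k.+1)) _.
  rewrite le_eqVlt; apply/orP; left; apply/eqP.
  congr (energy _ _ (_ + _)); apply: tau_ext => j _.
  case: dfwithP => [|j' neq_jk]; rewrite /splice ?ltnSn //.
  by rewrite [in RHS]ltnS [in RHS]leq_eqVlt eq_sym (negPf neq_jk).
have nu_k01 k : (k.+1 < d)%N -> 0 <= nu k.+1 <= 1.
  move=> kd; rewrite /nu /progress /=; case: eqP => [|/eqP den0]; first by rewrite ler01 lexx.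
  have den_gt0 : 0 < reduced_sqerr A y t Z k (splice k.+2 Z V).
    by rewrite lt0r den0 err_ge0 // ltnW.
  have q0 : 0 <= reduced_sqerr A y t Z k V / reduced_sqerr A y t Z k (splice k.+2 Z V).
    by rewrite divr_ge0 ?err_ge0 // ltnW.
  rewrite sqrtC_ge0 q0 /= -[1]sqrtC1 ler_sqrtC ?qualifE /= ?q0 ?ler01 //.
  by rewrite ler_pdivrMr // mul1r num_le_den.
have E_rec k : (k.+1 < d)%N -> reduced_sqerr A y t Z k V =
    nu k.+1 ^+ 2 * ((om k.+1 ^+ 2 - om k ^+ 2) * sqnorm A c + reduced_sqerr A y t Z k.+1 V).
  move=> kd; have -> : (om k.+1 ^+ 2 - om k ^+ 2) * sqnorm A c + reduced_sqerr A y t Z k.+1 V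
      = reduced_sqerr A y t Z k (splice k.+2 Z V).
    apply: (addrI (om k ^+ 2 * sqnorm A c)); rewrite -splice_den // splice_error //.
    by rewrite mulrBl addrA addrCA subrr addr0.
  (* If the denominator vanishes, the numerator is squeezed between 0 and it, so both sides are
     zero. *)
  rewrite /nu /progress /=; case: eqP => [den0|/eqP den0]; last by rewrite sqrtCK divfK.
  apply/eqP; rewrite den0 mulr0 eq_le err_ge0 ?(ltnW kd) // andbT.
  by rewrite -den0 num_le_den.
have E_last : reduced_sqerr A y t Z d.-1 V = 0.
  have dd : (d.-1 < d)%N by lia.
  have dS : d.-1.+1 = d by lia.
  (* The competitor for core d is the one whose tail is the reduced solution itself; its error is
     zero. *)
  have [||X tailX] := @tail_last C n r d.-1 (d - d.-1) (reduced_sol A y t Z d.-1).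
  - by lia.
  - by rewrite dS.
  apply/eqP; rewrite eq_le err_ge0 // andbT.
  rewrite -(lerD2l (om d.-1 ^+ 2 * sqnorm A c)) -splice_error // addr0.
  have d1 : (1 <= d.-1.+1 <= d)%N by lia.
  apply: le_trans (sweep _ d1 X) _.
  set W := dfwith _ X.
  have -> : tau d W = frame d Z d.-1 *m reduced_sol A y t Z d.-1.
    rewrite -(tailX W); last by rewrite /W dfwith_in.
    rewrite frame_splice_tail ?(ltnW dd) //; apply: tau_ext => j _.
    rewrite /splice; case: ltnP => // jd.
    by rewrite /W dfwith_out /splice ?jd //; lia.
  by rewrite energyE split_error // subrr sqnorm0 addr0.
have nu01 k : (1 <= k < d)%N -> 0 <= nu k <= 1.
  by case: k => // k kd; apply: nu_k01.
split=> [||k kd]; last by apply: nu01; lia.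
- rewrite -/(energy A y (t + tau d V)).
  (* The two families can differ only at core 0, which [tau] never reads. *)
  have -> : tau d V = tau d (splice 1 Z V) by apply: tau_ext => -[].
  rewrite splice_error ?om0 ?mul0r ?add0r; last by lia.
  (* The recursion starts at index 0, where om_0 = 0 turns the prefactor into 1. *)
  have := @nested_tail_error C nu om d (sqnorm A c)
    (fun k => reduced_sqerr A y t Z k V) (ltW cc_gt0) om_k01 nu01 E_rec E_last 0 d.-1.
  by rewrite om0 subr0 mul1r; apply; lia.
- congr (_ * _); rewrite /bound -[X in \sum_(_ <= _ < X) _](@prednK d) -?[d.-1.+1]add1n; last by lia.
  exact: nested_tail_sum.
Qed.
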